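(* Let $F=I_{n,m}$ denote the integral of products of Jacobi polynomials with parameters $n,m,\alpha,\beta,\rho,\delta,\mu,\nu$ defined in the context, with the shift notation explained there. Then $$\begin{aligned} &(n+1)(m+1)\big((n+m+\mu+\nu+4)\,F(n+,m+,\nu+)-2(\nu+1-\beta-\delta)\,F(n+,m+)\big)\\ &=(n+\beta+1)(m+1)\big((n+\alpha+\beta-m-\mu-\nu-2)\,F(m+,\nu+)+2(\nu+1-\beta-\delta)\,F(m+)\big)\\ &\quad+(n+1)(m+\delta+1)\big((-n+m+\rho+\delta-\mu-\nu-2)\,F(n+,\nu+)+2(\nu+1-\beta-\delta)\,F(n+)\big)\\ &\quad+(n+\beta+1)(m+\delta+1)\big((n+\alpha+\beta+m+\rho+\delta-\mu-\nu)\,F(\nu+)+2(\nu+1-\beta-\delta)\,F\big). \end{aligned}$$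
   Context: $(a)_k=a(a+1)\cdots(a+k-1)$, $(a)_0=1$. For real $\alpha,\beta$ and an integer $n\ge0$, the Jacobi polynomial is $P_n^{(\alpha,\beta)}(x)=\frac{(\alpha+1)_n}{n!}\,{}_2F_1\!\left(-n,n+\alpha+\beta+1;\alpha+1;\tfrac{1-x}{2}\right)=\sum_{k=0}^n\frac{(-n)_k(n+\alpha+\beta+1)_k(\alpha+k+1)_{n-k}}{n!\,k!}\left(\tfrac{1-x}{2}\right)^k$ (the last expression makes sense for all real $\alpha,\beta$). For integers $n,m\ge0$ and real $\alpha,\beta,\rho,\delta,\mu,\nu$ with $n+\alpha+\beta\ge0$, $m+\rho+\delta\ge0$, $\mu>-1$, $\nu>-1$ (admissible parameters), put $$F=I_{n,m}=\int_{-1}^1(1-x)^\mu(1+x)^\nu P_n^{(\alpha,\beta)}(x)\,P_m^{(\rho,\delta)}(x)\,dx,$$ regarded as a function of $(n,m,\alpha,\beta,\rho,\delta,\mu,\nu)$. Shift notation: $F$ followed by a list of parameters with signs denotes the value of $F$ after each listed parameter is increased by one (sign $+$) or decreased by one (sign $-$), all other parameters unchanged; e.g. $F(n+,m+,\nu+)$ has $n,m,\nu$ replaced by $n+1,m+1,\nu+1$. The identity is asserted for all parameters for which every occurrence of $F$ in it has admissible parameters. *)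

(* Defs.v *)
From mathcomp Require Import all_boot all_order all_algebra.
From mathcomp Require Import all_classical all_reals all_analysis.

Set Implicit Arguments.
Unset Strict Implicit.
Unset Printing Implicit Defensive.

Import Order.TTheory GRing.Theory Num.Theory.

Local Open Scope classical_set_scope.
Local Open Scope ring_scope.

Definition pochhammer (R : realType) (a : R) (k : nat) : R :=
  \prod_(i < k) (a + i%:R).

(* The hypergeometric sum with (alpha + 1)_n / (alpha + 1)_k cancelled to
   (alpha + k + 1)_(n - k), so that it makes sense for all real alpha, beta. *)
Definition jacobi (R : realType) (n : nat) (alpha beta : R) : {poly R} :=
  \sum_(k < n.+1)
     (pochhammer (- n%:R) k * pochhammer (n%:R + alpha + beta + 1) k
        * pochhammer (alpha + k%:R + 1) (n - k) / (n`!%:R * k`!%:R))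
       *: (2^-1 *: (1 - 'X)) ^+ k.

Definition admissible (R : realType) (n m : nat)
    (alpha beta rho delta mu nu : R) : Prop :=
  [/\ 0 <= n%:R + alpha + beta, 0 <= m%:R + rho + delta, -1 < mu & -1 < nu].

(* The open interval is used because the weight is singular at the endpoints
   when mu or nu is negative; for admissible parameters the integrand is
   Lebesgue-integrable on it, so this real-valued integral is not a junk
   value. *)
Definition jacobi_int (R : realType) (n m : nat)
    (alpha beta rho delta mu nu : R) : R :=
  \int[@lebesgue_measure R]_(x in `]-1, 1[)
     ((1 - x) `^ mu * (1 + x) `^ nu
        * (jacobi n alpha beta).[x] * (jacobi m rho delta).[x]).

(* Main.v *)
Require Import Defs.
From mathcomp Require Import all_boot all_order all_algebra.
From mathcomp Require Import all_classical all_reals all_analysis.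
From mathcomp Require Import measurable_realfun ring lra.

(** The identity says that the integral of an exact derivative vanishes.  Put
      G = (n + 1) P_{n+1} + (n + beta + 1) P_n,
      H = (m + 1) Q_{m+1} + (m + delta + 1) Q_m,
    with P, Q the Jacobi polynomials of parameters (alpha, beta) and
    (rho, delta), and move everything to the left side.  The terms without a
    shift of nu add up to the integral of -2 (nu + 1 - beta - delta) w G H,
    where w = (1 - x)^mu (1 + x)^nu; in the others the shift of nu amounts to a
    factor 1 + x, and they add up to the integral of
    (1 + x) w ((mu + nu + 2) G H + E H + G K), with
      E = (n + 1)^2 P_{n+1} - (n + alpha + beta + 1) (n + beta + 1) P_n
    and K the analogue of E for Q.  The combination G satisfies the first order
    relation (lemma jacobi_sum_deriv)
      (1 - x^2) G' = - (2 beta G + (1 + x) E),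
    and likewise for H.  Substituting both, the whole becomes minus the
    integral of the derivative of
      (1 - x)^(mu + 1) (1 + x)^(nu + 1) G H,
    a function which tends to 0 at both ends of the interval because mu and nu
    exceed -1.

    The first order relation is a comparison of coefficients in powers of
    (1 - x) / 2, hence a recurrence between products of Pochhammer symbols
    (jacobi_coef_recS).  The analytic part is the fundamental theorem
    of calculus for an integrand that may blow up at the endpoints
    (derive_Rintegral_oo), together with the integrability of w times a
    polynomial (integrable_weight_poly). *)

Set Implicit Arguments.
Unset Strict Implicit.
Unset Printing Implicit Defensive.

Import Order.TTheory GRing.Theory Num.Theory.
Import numFieldNormedType.Exports.

Local Open Scope classical_set_scope.
Local Open Scope ring_scope.

(** * Contiguous Jacobi polynomials *)

Section ContiguousJacobi.
Context {R : realType}.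
Implicit Types (a alpha beta : R) (n k : nat).

Lemma pochhammer0 a : pochhammer a 0 = 1.
Proof. by rewrite /pochhammer big_ord0. Qed.

Lemma pochhammerS a k : pochhammer a k.+1 = a * pochhammer (a + 1) k.
Proof.
rewrite /pochhammer big_ord_recl /= addr0; congr (_ * _).
by apply: eq_bigr => i _; rewrite /bump /= natrD addrA.
Qed.

Lemma pochhammerSr a k : pochhammer a k.+1 = pochhammer a k * (a + k%:R).
Proof. by rewrite /pochhammer big_ord_recr. Qed.

Lemma pochhammerN_eq0 n k : (n < k)%N -> pochhammer (- n%:R : R) k = 0.
Proof.
move=> nk; apply/eqP; rewrite /pochhammer prodf_seq_eq0.
apply/hasP; exists (Ordinal nk); first by rewrite mem_index_enum.
by rewrite /= addNr.
Qed.

(** The coefficient of ((1 - x) / 2) ^ k.  For k > n it is 0 on account of the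
    factor (-n)_k, so that the recurrence below holds for every k. *)
Definition jacobi_coef n alpha beta k : R :=
  pochhammer (- n%:R) k * pochhammer (n%:R + alpha + beta + 1) k
    * pochhammer (alpha + k%:R + 1) (n - k) / (n`!%:R * k`!%:R).

Lemma jacobi_coef_eq0 n alpha beta k : (n < k)%N ->
  jacobi_coef n alpha beta k = 0.
Proof. by move=> nk; rewrite /jacobi_coef pochhammerN_eq0// !mul0r. Qed.

Lemma jacobi_coef_rec0 n alpha beta :
  (n%:R + 1) * jacobi_coef n.+1 alpha beta 0 =
  (n%:R + alpha + 1) * jacobi_coef n alpha beta 0.
Proof.
rewrite /jacobi_coef !pochhammer0 !subn0 pochhammerSr factS natrM fact0 -natr1.
have : n`!%:R != 0 :> R by rewrite pnatr_eq0 -lt0n fact_gt0.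
have : n%:R + 1 != 0 :> R by rewrite natr1 pnatr_eq0.
by move=> *; field; rewrite ?natr1 ?pnatr_eq0 -?lt0n ?fact_gt0.
Qed.

(** For k < n all four coefficients are explicit multiples of
      (-n)_k (n + alpha + beta + 2)_k (alpha + k + 2)_{n - k - 1} / (n! k!)
    once (-n-1)_k and (n + alpha + beta + 1)_k are paired with the factors
    k - n - 1 and k + n + alpha + beta + 1 that stand next to them in the
    recurrence; what is left is a polynomial identity in n, k, alpha, beta.
    The cases k >= n involve vanishing coefficients. *)
Lemma jacobi_coef_recS n alpha beta k :
  (n%:R + 1) * (k%:R - beta - n%:R) * jacobi_coef n.+1 alpha beta k.+1
    + (n%:R + beta + 1) * (k%:R + n%:R + alpha + 2)
      * jacobi_coef n alpha beta k.+1
  = (n%:R + 1) * (k%:R - n%:R - 1) * jacobi_coef n.+1 alpha beta k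
    + (n%:R + beta + 1) * (k%:R + n%:R + alpha + beta + 1)
      * jacobi_coef n alpha beta k.
Proof.
have [nk|kn|<-] := ltngtP n k.
- rewrite !(@jacobi_coef_eq0 n) ?(@jacobi_coef_eq0 n.+1 _ _ k.+1)//; last first.
    exact: leqW.
  have [->|] := eqVneq k n.+1; first by rewrite -natr1; ring.
  move=> kn; rewrite jacobi_coef_eq0; first by ring.
  by rewrite ltn_neqAle eq_sym kn.
- have [j jE] : exists j, (n - k = j.+1)%N.
    by exists (n - k).-1; rewrite prednK// subn_gt0.
  have nE : n = (k + j.+1)%N by rewrite -jE subnKC// ltnW.
  rewrite /jacobi_coef !subSS subSn 1?ltnW// jE (_ : (n - k.+1 = j)%N); last first.
    by rewrite subnS jE.
  rewrite !factS !natrM -!natr1.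
  have -> : pochhammer (- (n%:R + 1)) k.+1 = - (n%:R + 1) * pochhammer (- n%:R : R) k.
    by rewrite pochhammerS; congr (_ * pochhammer _ _); ring.
  have Epoch : pochhammer (- (n%:R + 1)) k * (- (n%:R + 1) + k%:R)
      = - (n%:R + 1) * pochhammer (- n%:R : R) k.
    rewrite -pochhammerSr pochhammerS; congr (_ * pochhammer _ _); ring.
  have Es : pochhammer (n%:R + alpha + beta + 1) k * (n%:R + alpha + beta + 1 + k%:R)
     = (n%:R + alpha + beta + 1) * pochhammer (n%:R + 1 + alpha + beta + 1) k.
    by rewrite -pochhammerSr pochhammerS; congr (_ * pochhammer _ _); ring.
  rewrite (pochhammerS (n%:R + alpha + beta + 1)) (pochhammerSr (- n%:R)).
  rewrite (pochhammerSr (n%:R + 1 + alpha + beta + 1)).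
  rewrite (_ : n%:R + alpha + beta + 1 + 1 = n%:R + 1 + alpha + beta + 1); last ring.
  rewrite !(pochhammerS (alpha + k%:R + 1)).
  rewrite (_ : alpha + k%:R + 1 + 1 = alpha + (k%:R + 1) + 1); last ring.
  rewrite (pochhammerSr _ j).
  have jR : j%:R = n%:R - k%:R - 1 :> R by rewrite nE natrD -natr1; ring.
  rewrite jR.
  set A := pochhammer (- n%:R) k in Epoch *.
  set A' := pochhammer (- (n%:R + 1)) k in Epoch *.
  set B := pochhammer (n%:R + 1 + alpha + beta + 1) k in Es *.
  set B' := pochhammer (n%:R + alpha + beta + 1) k in Es *.
  set C := pochhammer _ j.
  have kf : k`!%:R != 0 :> R by rewrite pnatr_eq0 -lt0n fact_gt0.
  have nf : n`!%:R != 0 :> R by rewrite pnatr_eq0 -lt0n fact_gt0.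
  have k1 : k%:R + 1 != 0 :> R by rewrite natr1 pnatr_eq0.
  have n1 : n%:R + 1 != 0 :> R by rewrite natr1 pnatr_eq0.
  (* The two sides differ by a combination of the relations Epoch and Es. *)
  apply/eqP; rewrite -subr_eq0; apply/eqP.
  set N := n%:R in kf nf k1 n1 Epoch Es *; set K := k%:R in kf nf k1 n1 Epoch Es *.
  transitivity (- (A' * (- (N + 1) + K) - (- (N + 1) * A)) * B
      * (alpha + K + 1) * C * (alpha + N + 1) / (n`!%:R * k`!%:R)
    - (B' * (N + alpha + beta + 1 + K) - (N + alpha + beta + 1) * B)
      * (N + beta + 1) * A * (alpha + K + 1) * C / (n`!%:R * k`!%:R)).
    by field; rewrite ?kf ?nf ?k1 ?n1.
  by rewrite Epoch Es; ring.
- rewrite (@jacobi_coef_eq0 n _ _ n.+1)// /jacobi_coef subnn subSn// !subnn.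
  rewrite !pochhammer0 factS natrM -!natr1.
  have -> : pochhammer (- (n%:R + 1)) n.+1
      = - (n%:R + 1) * pochhammer (- n%:R : R) n.
    by rewrite pochhammerS; congr (_ * pochhammer _ _); ring.
  have -> : pochhammer (- (n%:R + 1)) n = (n%:R + 1) * pochhammer (- n%:R : R) n.
    apply: oppr_inj; rewrite -mulNr -[RHS](_ : pochhammer (- (n%:R + 1)) n.+1 = _).
      by rewrite pochhammerSr; ring.
    by rewrite pochhammerS; congr (_ * pochhammer _ _); ring.
  have Es : pochhammer (n%:R + alpha + beta + 1) n
        * (n%:R + alpha + beta + 1 + n%:R)
      = (n%:R + alpha + beta + 1) * pochhammer (n%:R + 1 + alpha + beta + 1) n.
    by rewrite -pochhammerSr pochhammerS; congr (_ * pochhammer _ _); ring.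
  rewrite (pochhammerSr (n%:R + 1 + alpha + beta + 1)) pochhammerS pochhammer0.
  set A := pochhammer (- n%:R) n.
  set B := pochhammer (n%:R + 1 + alpha + beta + 1) n in Es *.
  set B' := pochhammer (n%:R + alpha + beta + 1) n in Es *.
  have nf : n`!%:R != 0 :> R by rewrite pnatr_eq0 -lt0n fact_gt0.
  have n1 : n%:R + 1 != 0 :> R by rewrite natr1 pnatr_eq0.
  apply/eqP; rewrite -subr_eq0; apply/eqP.
  set N := n%:R in nf n1 Es *.
  transitivity (- (B' * (N + alpha + beta + 1 + N) - (N + alpha + beta + 1) * B)
      * (N + beta + 1) * A / (n`!%:R * n`!%:R)).
    by field; rewrite ?nf ?n1.
  by rewrite Es; ring.
Qed.

Lemma jacobiE n alpha beta :
  jacobi n alpha beta =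
  (\poly_(k < n.+1) jacobi_coef n alpha beta k) \Po (2^-1 *: (1 - 'X)).
Proof.
rewrite poly_def raddf_sum /=; apply: eq_bigr => k _.
by rewrite comp_polyZ comp_Xn_poly.
Qed.

Lemma coef_jacobi_poly n alpha beta k :
  (\poly_(i < n.+1) jacobi_coef n alpha beta i)`_k = jacobi_coef n alpha beta k.
Proof. by rewrite coef_poly ltnS; case: leqP => // /jacobi_coef_eq0 ->. Qed.

(** Up to a constant this is (1 + x) P_n^(alpha, beta + 1)(x). *)
Definition jacobi_sum n alpha beta : {poly R} :=
  (n%:R + 1) *: jacobi n.+1 alpha beta + (n%:R + beta + 1) *: jacobi n alpha beta.

(** The partner of [jacobi_sum] in its first order differential relation. *)
Definition jacobi_diff n alpha beta : {poly R} :=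
  (n%:R + 1) ^+ 2 *: jacobi n.+1 alpha beta
  - ((n%:R + alpha + beta + 1) * (n%:R + beta + 1)) *: jacobi n alpha beta.

(** In the variable t = (1 - x) / 2 the relation reads
    t (1 - t) G_t = beta G + (1 - t) E, whose coefficient of t^(k + 1) is
    [jacobi_coef_recS] and whose constant term is [jacobi_coef_rec0]. *)
Lemma jacobi_sum_deriv n alpha beta :
  (1 - 'X ^+ 2) * (jacobi_sum n alpha beta)^`()
  = - ((2 * beta) *: jacobi_sum n alpha beta + (1 + 'X) * jacobi_diff n alpha beta).
Proof.
rewrite /jacobi_sum /jacobi_diff !jacobiE.
set p := \poly_(k < n.+2) _; set q := \poly_(k < n.+1) _.
set t := 2^-1 *: (1 - 'X).
pose G := (n%:R + 1) *: p + (n%:R + beta + 1) *: q.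
pose E := (n%:R + 1) ^+ 2 *: p - ((n%:R + alpha + beta + 1) * (n%:R + beta + 1)) *: q.
have GE : 'X * G^`() - 'X * ('X * G^`()) = beta *: G + (E - 'X * E).
  apply/polyP => -[|k].
    rewrite !(coefB, coefD, coefZ, coefXM) !coef_jacobi_poly /=.
    have := jacobi_coef_rec0 n alpha beta.
    set c := jacobi_coef _ _ _ _; set d := jacobi_coef _ _ _ _ => H.
    transitivity ((n%:R + beta + 1) * ((n%:R + 1) * c - (n%:R + alpha + 1) * d)).
      by rewrite H; ring.
    by ring.
  have XG : (if k == 0%N then 0 else G^`()`_k.-1) = k%:R * G`_k.
    by case: k => [|k]; rewrite ?mul0r//= coef_deriv mulr_natl.
  rewrite !(coefB, coefD, coefZ, coefXM) /= XG coef_deriv -[_ *+ k.+1]mulr_natl.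
  rewrite !(coefB, coefD, coefZ) !coef_jacobi_poly -natr1.
  have := jacobi_coef_recS n alpha beta k.
  set c := jacobi_coef n.+1 _ _ _; set d := jacobi_coef n _ _ k.+1.
  set c' := jacobi_coef n.+1 _ _ k; set d' := jacobi_coef n _ _ k.
  move=> /eqP; rewrite -subr_eq0 => /eqP H.
  by apply/eqP; rewrite -subr_eq0 -H; apply/eqP; ring.
have tX : 'X = 1 - 2 * t.
  rewrite /t -mul_polyC mulrA -[2](rmorph_nat polyC) -polyCM divff ?pnatr_eq0//.
  by rewrite mul1r opprB addrC subrK.
have dt : t^`() *+ 2 = - 1.
  rewrite /t derivZ derivB derivX -polyC1 derivC sub0r scalerMnl -mulr_natr.
  by rewrite mulVf ?pnatr_eq0// scale1r.
have dG : (G \Po t)^`() *+ 2 = - (G^`() \Po t).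
  by rewrite deriv_comp -mulrnAr dt mulrN1.
have GEt : t * (G^`() \Po t) - t * (t * (G^`() \Po t))
    = beta *: (G \Po t) + ((E \Po t) - t * (E \Po t)).
  move: GE => /(congr1 (comp_poly t)); move: (G) (E) => g e.
  by rewrite !(comp_polyB, comp_polyD, comp_polyZ, comp_polyM, comp_polyX).
rewrite (_ : _ *: (p \Po t) + _ = G \Po t); last first.
  by rewrite comp_polyD !comp_polyZ.
rewrite (_ : _ *: (p \Po t) - _ = E \Po t); last first.
  by rewrite comp_polyB !comp_polyZ.
move: GEt; rewrite -[G^`() \Po t]opprK -dG.
move: (G \Po t) (E \Po t) => g e ge.
transitivity (- (t * - (g^`() *+ 2) - t * (t * - (g^`() *+ 2))) *+ 2).
  by rewrite tX; ring.
by rewrite ge tX -!mul_polyC polyCM; ring.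
Qed.
End ContiguousJacobi.

(** * The fundamental theorem of calculus on an open interval *)

Section OpenIntervalFTC.
Context {R : realType}.
Notation mu := (@lebesgue_measure R).
Context (f F : R -> R) (a b : R) (ab : a < b).
Context (Ff : forall x : R, x \in `]a, b[ -> is_derive x 1 F (f x)).
Context (cf : {in `]a, b[, continuous f}).
Context (Fa : F x @[x --> a^'+] --> F a) (Fb : F x @[x --> b^'-] --> F b).

Let F'f : {in `]a, b[, F^`()%classic =1 f}.
Proof. by move=> x xab; rewrite derive1E; have [_ ->] := Ff xab. Qed.

Let dF : derivable_oo_LRcontinuous F a b.
Proof. by split => // x xab; have [] := Ff xab. Qed.

Let cF : {within `[a, b], continuous F}.
Proof. exact: derivable_oo_LRcontinuous_within dF. Qed.

Let mf : measurable_fun `]a, b[ f.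
Proof. by apply: open_continuous_measurable_fun => // x /set_mem; exact: cf. Qed.

(** On each compact subinterval the integral of f is an increment of the
    nondecreasing function F, hence at most F b - F a; monotone convergence
    along an exhaustion keeps this bound. *)
Lemma ge0_derive_integrable_oo : (forall x : R, x \in `]a, b[ -> 0 <= f x) ->
  mu.-integrable `]a, b[ (EFin \o f).
Proof.
move=> f0.
(* With n + 3 the subinterval is nondegenerate already for n = 0. *)
pose d n : R := (b - a) / n.+3%:R.
pose I n : set R := `[a + d n, b - d n]%classic.
have d_gt0 n : 0 < d n by rewrite divr_gt0// subr_gt0.
have d_noninc m n : (m <= n)%N -> d n <= d m.
  by move=> mn; rewrite ler_pM2l ?subr_gt0// lef_pV2 ?posrE// ler_nat.
have lt_d n : a + d n < b - d n.
  rewrite ltrBrDr -addrA -ltrBrDl -mulr2n -mulr_natr /d -mulrA.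
  by rewrite gtr_pMr ?subr_gt0// mulrC ltr_pdivrMr// mul1r ltr_nat.
have I_oo n (x : R) : x \in `[a + d n, b - d n] -> x \in `]a, b[.
  rewrite !in_itv/= => /andP[ax xb].
  by rewrite (lt_le_trans _ ax) ?ltrDl//= (le_lt_trans xb)// gtrBl.
have bigI : \bigcup_n I n = `]a, b[%classic.
  apply/seteqP; split => [x [n _]|x]; first exact: I_oo.
  rewrite /= in_itv/= => /andP[ax xb].
  pose e := Num.min (x - a) (b - x).
  have e0 : 0 < e by rewrite /e lt_min !subr_gt0 ax.
  have [n ltn] : exists n, (b - a) / e < n%:R.
    by exists (Num.bound ((b - a) / e)); rewrite archi_boundP// divr_ge0 ?ltW// subr_gt0.
  exists n => //; rewrite /I /= in_itv/=.
  have : d n <= e.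
    rewrite /d ler_pdivrMr// mulrC -ler_pdivrMr// (le_trans (ltW ltn))//.
    by rewrite ler_nat -addn3 leq_addr.
  by rewrite /e le_min => /andP[? ?]; apply/andP; split; lra.
have F_homo x y : a <= x -> x <= y -> y <= b -> F x <= F y.
  apply: ger0_derive1_ndecr => // z zab; first by have [] := Ff zab.
  by rewrite F'f// f0.
have cF_oo x : x \in `]a, b[ -> {for x, continuous F}.
  by move=> xab; apply/differentiable_continuous/derivable1_diffP; have [] := Ff xab.
have intI n : (\int[mu]_(x in I n) (f x)%:E <= (F b - F a)%:E)%E.
  rewrite (@continuous_FTC2 _ f F)//.
  - rewrite -EFinB lee_fin lerB// F_homo//; have := lt_d n; have := d_gt0 n; lra.
  - apply: (@continuous_subspaceW _ _ _ `]a, b[); first exact: I_oo.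
    by rewrite continuous_open_subspace// => x /set_mem; exact: cf.
  - split => [x /subset_itv_oo_cc/I_oo xab||].
    + by have [] := Ff xab.
    + apply: cvg_at_right_filter; apply: cF_oo; apply: (I_oo n).
      by rewrite in_itv/= lexx ltW.
    + apply: cvg_at_left_filter; apply: cF_oo; apply: (I_oo n).
      by rewrite in_itv/= lexx ltW.
  - by move=> x /subset_itv_oo_cc/I_oo; exact: F'f.
apply/integrableP; split; first exact/measurable_EFinP.
rewrite (@le_lt_trans _ _ (F b - F a)%:E) ?ltry//.
under eq_integral => x /set_mem xab do rewrite /= ger0_norm ?f0//.
rewrite -bigI.
have nI : nondecreasing_seq I.
  apply/nondecreasing_seqP => n; rewrite subsetEset.
  by apply: subset_itv; rewrite bnd_simp ?lerD2l ?lerN2 d_noninc.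
have mI n : measurable_fun (I n) (EFin \o f).
  apply/measurable_EFinP; apply: measurable_funS mf => // x; exact: I_oo.
have f0I n x : I n x -> (0 <= (EFin \o f) x)%E by move=> /I_oo/f0; rewrite lee_fin.
have cvgI := @ge0_nondecreasing_set_cvg_integral _ (measurableTypeR R) R I
  (EFin \o f) mu nI (fun n => measurable_itv _) mI f0I.
rewrite -(cvg_lim _ cvgI)//; apply: lime_le; last exact: nearW.
by apply/cvg_ex; eexists; exact: cvgI.
Qed.

(** The indefinite integral of f is continuous on the closed interval, and its
    derivative inside is f, by continuity of f there.  So its difference with F
    is constant by the mean value theorem. *)
Lemma derive_Rintegral_oo : mu.-integrable `]a, b[ (EFin \o f) ->
  \int[mu]_(x in `]a, b[) f x = F b - F a.
Proof.
move=> fi; pose g := f \_ `]a, b[.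
have gi : mu.-integrable `[a, b] (EFin \o g).
  rewrite -restrict_EFin; apply: (@integrableS _ _ _ _ setT) => //.
  exact/(integrable_mkcond _ _).1.
pose G x := \int[mu]_(t in `[a, x]) g t.
have dG x : x \in `]a, b[ -> is_derive x 1 G (f x).
  move=> xab; have /andP[ax xb] : a < x < b by rewrite in_itv in xab.
  have cg : {for x, continuous g}.
    rewrite /prop_for /continuous_at /g patchE mem_set//.
    apply: cvg_trans (cf xab); apply: near_eq_cvg.
    near=> y; rewrite patchE mem_set//.
    by near: y; exact: near_in_itvoo.
  have [dG GE] := continuous_FTC1_closed xb gi ax cg.
  apply: DeriveDef; first exact: dG.
  by rewrite -derive1E GE /g patchE mem_set.
have cG : {within `[a, b], continuous G}.
  exact: (parameterized_integral_continuous (ltW ab) gi).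
have [x xab||c _] := @MVT _ (F \- G) (cst 0) a b ab.
- rewrite /cst -(subrr (f x)); apply: is_deriveB; [exact: Ff|exact: dG].
- by move=> x; apply: cvgB; [exact: cF|exact: cG].
have -> : \int[mu]_(x in `]a, b[) f x = G b.
  rewrite /G -Rintegral_itv_obnd_cbnd; last first.
    by apply: integrableS gi => //; exact: subset_itv_oc_cc.
  rewrite -Rintegral_itv_bndo_bndc; last first.
    by apply: integrableS gi => //; exact: subset_itv_oo_cc.
  by apply: eq_Rintegral => x xab; rewrite /g patchE xab.
have Ga : G a = 0 by rewrite /G set_itv1 Rintegral_set1.
by rewrite /= Ga mul0r subr0; lra.
Unshelve. all: by end_near. Qed.
End OpenIntervalFTC.

(** * Integrals of polynomials against the Jacobi weight *)

Lemma cvg_powR0 {R : realType} {T : Type} {F : set_system T} {FF : Filter F}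
    (u : T -> R) (p : R) :
  0 < p -> u x @[x --> F] --> 0 -> (\forall x \near F, 0 < u x) ->
  u x `^ p @[x --> F] --> 0.
Proof.
move=> p0 u0 u_gt0.
have u0' : u x @[x --> F] --> 0^'+.
  move=> A /= A0; rewrite nbhs_filterE /=; near=> x.
  suff: 0 < u x -> A (u x) by apply; near: x.
  by near: x; exact: u0 A0.
exact: (cvg_comp _ _ u0' (powR_cvg0 p0)).
Unshelve. all: by end_near. Qed.

Section JacobiWeight.
Context {R : realType}.
Notation mu := (@lebesgue_measure R).
Implicit Types (a b x : R) (r : {poly R}).

Definition weight a b x : R := (1 - x) `^ a * (1 + x) `^ b.

Lemma is_derive_1Dx_powR b x : -1 < x ->
  is_derive x (1 : R) (fun y : R => (1 + y) `^ b) (b * (1 + x) `^ (b - 1)).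
Proof.
move=> x1.
have dp : is_derive (1 + x) (1 : R) (@powR R ^~ b) (b * (1 + x) `^ (b - 1)).
  by apply: is_derive1_powR; lra.
have du : is_derive x (1 : R) (fun y : R => 1 + y) 1.
  by rewrite -[X in is_derive _ _ _ X]add0r; exact: is_deriveD.
by have := is_derive1_comp dp du; rewrite mulr1.
Qed.

Lemma is_derive_1Bx_powR a x : x < 1 ->
  is_derive x (1 : R) (fun y : R => (1 - y) `^ a) (- (a * (1 - x) `^ (a - 1))).
Proof.
move=> x1.
have dp : is_derive (1 - x) (1 : R) (@powR R ^~ a) (a * (1 - x) `^ (a - 1)).
  by apply: is_derive1_powR; lra.
have du : is_derive x (1 : R) (fun y : R => 1 - y) (- 1).
  by rewrite -[X in is_derive _ _ _ X]sub0r; exact: is_deriveB.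
have := @is_derive1_comp _ (@powR R ^~ a) (fun y : R => 1 - y) _ _ _ dp du.
by rewrite mulrN1.
Qed.

Lemma powRS (x a : R) : 0 < x -> x `^ (a + 1) = x * x `^ a.
Proof.
move=> x0; rewrite powRD; last by apply/implyP => _; rewrite gt_eqF.
by rewrite powRr1 ?ltW// mulrC.
Qed.

(** Raising both exponents by one makes the derivative divisible by the
    original weight, with a polynomial quotient. *)
Lemma is_derive_weight_poly a b r x : -1 < x < 1 ->
  is_derive x (1 : R) (fun y : R => weight (a + 1) (b + 1) y * r.[y])
    (weight a b x *
     (((b + 1) *: (1 - 'X) - (a + 1) *: (1 + 'X)) * r + (1 - 'X ^+ 2) * r^`()).[x]).
Proof.
move=> /andP[xN1 x1].
have := is_deriveM (is_deriveM (is_derive_1Bx_powR (a + 1) x1)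
  (is_derive_1Dx_powR (b + 1) xN1)) (is_derive_poly r x).
move=> /is_derive_eq; apply.
rewrite !fctE /weight !addrK !powRS; [|lra..].
by rewrite !hornerE /GRing.scale/=; ring.
Qed.


Lemma cvg_1Dx_powR b : 0 < b -> (1 + x) `^ b @[x --> (-1 : R)^'+] --> (0 : R).
Proof.
move=> b0; apply: cvg_powR0 => //.
  apply: cvg_at_right_filter; rewrite -(subrr 1).
  by apply: cvgD; [exact: cvg_cst|exact: cvg_id].
by near=> x; rewrite -ltrBlDl sub0r; near: x; exact: nbhs_right_gt.
Unshelve. all: by end_near. Qed.

Lemma cvg_1Bx_powR a : 0 < a -> (1 - x) `^ a @[x --> (1 : R)^'-] --> (0 : R).
Proof.
move=> a0; apply: cvg_powR0 => //.
  apply: cvg_at_left_filter; rewrite -(subrr 1).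
  by apply: cvgB; [exact: cvg_cst|exact: cvg_id].
by near=> x; rewrite subr_gt0; near: x; exact: nbhs_left_lt.
Unshelve. all: by end_near. Qed.

Lemma continuous_1Dx_powR b x : -1 < x -> {for x, continuous (fun y : R => (1 + y) `^ b)}.
Proof.
by move=> x1; apply/differentiable_continuous/derivable1_diffP;
  have [] := is_derive_1Dx_powR b x1.
Qed.

Lemma continuous_1Bx_powR a x : x < 1 -> {for x, continuous (fun y : R => (1 - y) `^ a)}.
Proof.
by move=> x1; apply/differentiable_continuous/derivable1_diffP;
  have [] := is_derive_1Bx_powR a x1.
Qed.

Lemma integrable_1Dx_powR b : -1 < b ->
  mu.-integrable `]-1, 1[ (EFin \o (fun x : R => (1 + x) `^ b)).
Proof.
move=> b1; have b0 : 0 < b + 1 by lra.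
apply: (@ge0_derive_integrable_oo _ _ (fun x => (b + 1)^-1 * (1 + x) `^ (b + 1))).
- lra.
- move=> x; rewrite in_itv/= => /andP[x1 _].
  have := is_deriveZ (b + 1)^-1 (is_derive_1Dx_powR (b + 1) x1).
  by move=> /is_derive_eq; apply; rewrite /GRing.scale/= addrK mulKf// gt_eqF.
- by move=> x; rewrite in_itv/= => /andP[x1 _]; exact: continuous_1Dx_powR.
- rewrite subrr powR0 ?gt_eqF//; apply: cvgM; [exact: cvg_cst|exact: cvg_1Dx_powR].
- apply: cvg_at_left_filter; apply: cvgM; first exact: cvg_cst.
  by apply: continuous_1Dx_powR; lra.
- by move=> x _; exact: powR_ge0.
Qed.

Lemma integrable_1Bx_powR a : -1 < a ->
  mu.-integrable `]-1, 1[ (EFin \o (fun x : R => (1 - x) `^ a)).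
Proof.
move=> a1; have a0 : 0 < a + 1 by lra.
apply: (@ge0_derive_integrable_oo _ _ (fun x => - (a + 1)^-1 * (1 - x) `^ (a + 1))).
- lra.
- move=> x; rewrite in_itv/= => /andP[_ x1].
  have := is_deriveZ (- (a + 1)^-1) (is_derive_1Bx_powR (a + 1) x1).
  by move=> /is_derive_eq; apply; rewrite /GRing.scale/= addrK mulrNN mulKf// gt_eqF.
- by move=> x; rewrite in_itv/= => /andP[_ x1]; exact: continuous_1Bx_powR.
- apply: cvg_at_right_filter; apply: cvgM; first exact: cvg_cst.
  by apply: continuous_1Bx_powR; lra.
- rewrite subrr powR0 ?gt_eqF//; apply: cvgM; [exact: cvg_cst|exact: cvg_1Bx_powR].
- by move=> x _; exact: powR_ge0.
Qed.

(** Bounds the factor of the weight that is regular at the nearer endpoint,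
    whatever the sign of its exponent. *)
Lemma powR_le_1D2 (x p : R) : 1 <= x <= 2 -> x `^ p <= 1 + 2 `^ p.
Proof.
move=> /andP[x1 x2]; have [p0|p0] := leP 0 p.
  by apply: (@le_trans _ _ (2 `^ p)); [rewrite ge0_ler_powR// nnegrE; lra|rewrite lerDr].
have := ler_powR x1 (ltW p0); rewrite powRr0 => /le_trans; apply.
by rewrite lerDl powR_ge0.
Qed.

Lemma weight_ge0 a b x : 0 <= weight a b x.
Proof. by rewrite mulr_ge0 ?powR_ge0. Qed.

Lemma measurable_weight a b D : measurable_fun D (weight a b).
Proof.
apply: measurable_funTS; apply: measurable_funM.
  by apply: (measurableT_comp (measurable_powR a)); exact: measurable_funB.
by apply: (measurableT_comp (measurable_powR b)); exact: measurable_funD.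
Qed.

(** Each half of the interval contains a single singularity: the weight is at
    most a constant times (1 - x)^a for x >= 0, and a constant times (1 + x)^b
    for x < 0. *)
Lemma integrable_weight a b : -1 < a -> -1 < b ->
  mu.-integrable `]-1, 1[ (EFin \o weight a b).
Proof.
move=> a1 b1.
pose g x := (1 + 2 `^ a) * (1 + x) `^ b + (1 + 2 `^ b) * (1 - x) `^ a.
have gi : mu.-integrable `]-1, 1[ (EFin \o g).
  have m11 : measurable (`]-1, 1[%classic : set (measurableTypeR R)).
    exact: measurable_itv.
  have := integrableD m11
    (integrableZl m11 (1 + 2 `^ a) (integrable_1Dx_powR b1))
    (integrableZl m11 (1 + 2 `^ b) (integrable_1Bx_powR a1)).
  exact.
apply: le_integrable gi => //.
- by apply/measurable_EFinP; exact: measurable_weight.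
- move=> x; rewrite /= in_itv/= => /andP[xN1 x1].
  have gp p : 0 <= 1 + (2 : R) `^ p by rewrite addr_ge0 ?powR_ge0.
  rewrite lee_fin ger0_norm ?weight_ge0// ger0_norm; last first.
    by rewrite addr_ge0// mulr_ge0 ?powR_ge0.
  have [x0|x0] := leP 0 x.
    apply: ler_wpDl; first by rewrite mulr_ge0 ?powR_ge0.
    by rewrite /weight mulrC ler_wpM2r ?powR_ge0// powR_le_1D2//; apply/andP; split; lra.
  apply: ler_wpDr; first by rewrite mulr_ge0 ?powR_ge0.
  by rewrite /weight ler_wpM2r ?powR_ge0// powR_le_1D2//; apply/andP; split; lra.
Qed.

Lemma integrable_weight_poly a b r : -1 < a -> -1 < b ->
  mu.-integrable `]-1, 1[ (EFin \o (fun x => weight a b x * r.[x])).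
Proof.
move=> a1 b1.
have m11 : measurable (`]-1, 1[%classic : set (measurableTypeR R)).
  exact: measurable_itv.
have mr : measurable_fun (`]-1, 1[ : set (measurableTypeR R)) (horner r).
  by apply: measurable_funTS; apply: continuous_measurable_fun; exact: continuous_horner.
have br : [bounded r.[x] | x in (`]-1, 1[ : set R)].
  have cr : {within `[-1, 1], continuous (horner r)}.
    by apply: continuous_subspaceT; exact: continuous_horner.
  have /compact_bounded[M [_ Mr]] := continuous_compact cr (@segment_compact _ (-1) 1).
  exists M; split; rewrite ?num_real// => y My x xab.
  by apply: (Mr y My); exists x => //; exact: subset_itv_oo_cc.
have := integrableMl m11 (integrable_weight a1 b1) mr br.
exact.
Qed.

Definition weight_int a b r : R :=
  \int[mu]_(x in `]-1, 1[) (weight a b x * r.[x]).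

Lemma weight_intD a b r s : -1 < a -> -1 < b ->
  weight_int a b (r + s) = weight_int a b r + weight_int a b s.
Proof.
move=> a1 b1; rewrite /weight_int -RintegralD//; try exact: integrable_weight_poly.
by apply: eq_Rintegral => x _; rewrite hornerD mulrDr.
Qed.

Lemma weight_intZ a b c r : -1 < a -> -1 < b ->
  weight_int a b (c *: r) = c * weight_int a b r.
Proof.
move=> a1 b1; rewrite /weight_int -RintegralZl//; last exact: integrable_weight_poly.
by apply: eq_Rintegral => x _; rewrite hornerZ mulrCA.
Qed.

Lemma weight_int_shift a b r : weight_int a (b + 1) r = weight_int a b ((1 + 'X) * r).
Proof.
apply: eq_Rintegral => x; rewrite inE/= in_itv/= => /andP[x1 _].
rewrite /weight powRS; last lra.
by rewrite hornerM hornerD hornerX -polyC1 hornerC -!mulrA [(1 + x) * (_ * _)]mulrCA.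
Qed.

(** By [is_derive_weight_poly] the integrand is the derivative of
    (1 - x)^(a + 1) (1 + x)^(b + 1) r(x), which vanishes at both endpoints. *)
Lemma weight_int_derive a b r : -1 < a -> -1 < b ->
  weight_int a b
    (((b + 1) *: (1 - 'X) - (a + 1) *: (1 + 'X)) * r + (1 - 'X ^+ 2) * r^`()) = 0.
Proof.
move=> a1 b1; pose F x := weight (a + 1) (b + 1) x * r.[x].
have a0 : 0 < a + 1 by lra.
have b0 : 0 < b + 1 by lra.
have Fa : F (-1) = 0 by rewrite /F /weight subrr powR0 ?gt_eqF// mulr0 mul0r.
have Fb : F 1 = 0 by rewrite /F /weight subrr powR0 ?gt_eqF// !mul0r.
transitivity (F 1 - F (-1)); last by rewrite Fa Fb subrr.
apply: derive_Rintegral_oo; rewrite ?Fa ?Fb.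
- lra.
- by move=> x; rewrite in_itv; exact: is_derive_weight_poly.
- move=> x; rewrite in_itv/= => /andP[xN1 x1]; apply: cvgM; last exact: continuous_horner.
  by apply: cvgM; [exact: continuous_1Bx_powR|exact: continuous_1Dx_powR].
- have : 2 `^ (a + 1) * 0 * r.[-1] = 0 by rewrite mulr0 mul0r.
  move=> <-; apply: cvgM; last by apply: cvg_at_right_filter; exact: continuous_horner.
  apply: cvgM; last exact: cvg_1Dx_powR.
  apply: cvg_at_right_filter; rewrite (_ : 2 = 1 - -1); last by ring.
  by apply: continuous_1Bx_powR; lra.
- have : 0 * 2 `^ (b + 1) * r.[1] = 0 by rewrite !mul0r.
  move=> <-; apply: cvgM; last by apply: cvg_at_left_filter; exact: continuous_horner.
  apply: cvgM; first exact: cvg_1Bx_powR.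
  apply: cvg_at_left_filter; rewrite (_ : 2 = 1 + 1); last by ring.
  by apply: continuous_1Dx_powR; lra.
- exact: integrable_weight_poly.
Qed.

Lemma jacobi_intE n m alpha beta rho delta a b :
  jacobi_int n m alpha beta rho delta a b =
  weight_int a b (jacobi n alpha beta * jacobi m rho delta).
Proof. by apply: eq_Rintegral => x _; rewrite hornerM mulrA. Qed.
End JacobiWeight.

(** * The recurrence for the integrals *)

(* Only n, m and nu are shifted, and always upwards, and the unshifted F occurs
   in the identity; hence admissibility of the unshifted parameters is
   equivalent to admissibility of every occurrence. *)
Theorem theorem4p12 (R : realType) (n m : nat)
    (alpha beta rho delta mu nu : R)
    (hadm : admissible n m alpha beta rho delta mu nu) :
  let F (n' m' : nat) (nu' : R) :=
    jacobi_int n' m' alpha beta rho delta mu nu' in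
  (n%:R + 1) * (m%:R + 1)
    * ((n%:R + m%:R + mu + nu + 4) * F n.+1 m.+1 (nu + 1)
       - 2 * (nu + 1 - beta - delta) * F n.+1 m.+1 nu)
  = (n%:R + beta + 1) * (m%:R + 1)
      * ((n%:R + alpha + beta - m%:R - mu - nu - 2) * F n m.+1 (nu + 1)
         + 2 * (nu + 1 - beta - delta) * F n m.+1 nu)
    + (n%:R + 1) * (m%:R + delta + 1)
      * ((- n%:R + m%:R + rho + delta - mu - nu - 2) * F n.+1 m (nu + 1)
         + 2 * (nu + 1 - beta - delta) * F n.+1 m nu)
    + (n%:R + beta + 1) * (m%:R + delta + 1)
      * ((n%:R + alpha + beta + m%:R + rho + delta - mu - nu) * F n m (nu + 1)
         + 2 * (nu + 1 - beta - delta) * F n m nu).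
Proof.
case: hadm => _ _ mu1 nu1 F.
rewrite /F !jacobi_intE !weight_int_shift.
set P' := jacobi n.+1 _ _; set P := jacobi n _ _.
set Q' := jacobi m.+1 _ _; set Q := jacobi m _ _.
have := weight_int_derive (jacobi_sum n alpha beta * jacobi_sum m rho delta) mu1 nu1.
set r := (X in weight_int _ _ X) => H.
apply/eqP; rewrite -subr_eq0; apply/eqP; rewrite -oppr0 -[in RHS]H.
(* The sign is that of the derivative, which is the right side minus the left. *)
have -> : r = - 1 *: (
    ((n%:R + 1) * (m%:R + 1) * (n%:R + m%:R + mu + nu + 4)) *: ((1 + 'X) * (P' * Q'))
  + (- ((n%:R + 1) * (m%:R + 1) * (2 * (nu + 1 - beta - delta)))) *: (P' * Q')
  + (- ((n%:R + beta + 1) * (m%:R + 1) * (n%:R + alpha + beta - m%:R - mu - nu - 2)))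
     *: ((1 + 'X) * (P * Q'))
  + (- ((n%:R + beta + 1) * (m%:R + 1) * (2 * (nu + 1 - beta - delta)))) *: (P * Q')
  + (- ((n%:R + 1) * (m%:R + delta + 1) * (- n%:R + m%:R + rho + delta - mu - nu - 2)))
     *: ((1 + 'X) * (P' * Q))
  + (- ((n%:R + 1) * (m%:R + delta + 1) * (2 * (nu + 1 - beta - delta)))) *: (P' * Q)
  + (- ((n%:R + beta + 1) * (m%:R + delta + 1)
      * (n%:R + alpha + beta + m%:R + rho + delta - mu - nu))) *: ((1 + 'X) * (P * Q))
  + (- ((n%:R + beta + 1) * (m%:R + delta + 1) * (2 * (nu + 1 - beta - delta))))
     *: (P * Q)).
  rewrite /r derivM [(1 - 'X ^+ 2) * _]mulrDr [(1 - 'X ^+ 2) * (_^`() * _)]mulrA.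
  rewrite [(1 - 'X ^+ 2) * (_ * _)]mulrCA !jacobi_sum_deriv.
  rewrite /jacobi_sum /jacobi_diff -/P' -/P -/Q' -/Q -!mul_polyC.
  ring.
rewrite !(weight_intZ, weight_intD)//.
ring.
Qed.
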